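(* Let $(\Sigma,\mathscr R)$ be a Dedukti theory with $\hookrightarrow_{\beta\mathscr R}$ confluent and $\mathscr R$ arity-preserving, and let $M$ be an object or a type family. (1) If $N$ is an object, then $M\{N/x\}$ is an object or a type family and $|M\{N/x\}|=|M|\{|N|/x\}$. (2) If $M\hookrightarrow_\beta N$, then $N$ is an object or a type family and $|M|\hookrightarrow_\beta^+|N|$.
   Context: Dedukti terms $x\mid c[\vec M]\mid\mathtt{TYPE}\mid\mathtt{KIND}\mid MN\mid\lambda x:A.M\mid\Pi x:A.B$ with constants of fixed arity, declared in a signature $\Sigma$ as $c[\Delta]:A$; a constant is type-level (written $\alpha$) if its declared type is of the form $\Pi\vec x:\vec B.\mathtt{TYPE}$, otherwise object-level (written $a$); a rule is type-level if its head constant is. $\mathscr R$ is arity-preserving if every type-level rule has right-hand side in $R::=\alpha[\vec M]\mid R\,N\mid\lambda x:A.R$. Type families and objects: $T::=\alpha[\vec O]\mid T\,O\mid\lambda x:T.T\mid\Pi x:T.T$; $O::=x\mid a[\vec O]\mid O\,O\mid\lambda x:T.O$. Simple types $\sigma::=*\mid\sigma\to\sigma$ with constants $\pi_\sigma:*\to(\sigma\to* )\to*$. Partial maps: $\|\mathtt{TYPE}\|=*$, $\|\alpha[\vec M]\|=*$, $\|\Pi x:A.B\|=\|A\|\to\|B\|$, $\|A\,N\|=\|A\|$, $\|\lambda x:A.B\|=\|B\|$; $|x|=x$, $|c[M_1,\dots,M_n]|=c\,|M_1|\cdots|M_n|$, $|MN|=|M|\,|N|$, $|\lambda x:A.M|=(\lambda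 z.\lambda x.|M|)\,|A|$ with $z$ fresh, $|\Pi x:A.B|=\pi_{\|A\|}\,|A|\,(\lambda x.|B|)$. $\hookrightarrow_\beta^+$ denotes one or more $\beta$-steps in the untyped $\lambda$-calculus with constants. *)

(* Defs.v *)
From mathcomp Require Import all_boot.
From Stdlib Require Import Relation_Operators.

Set Implicit Arguments.
Unset Strict Implicit.
Unset Printing Implicit Defensive.

(** * Dedukti terms

    [C] is the set of constants declared in the signature and [ar c] is the
    arity of [c], so that [Cst c Ms] always carries exactly [ar c] arguments.
    Terms up to alpha-equivalence are represented with de Bruijn indices:
    [Lam A M] and [Pi A B] bind index 0 in [M] and in [B] (not in [A]). *)

Inductive term (C : Type) (ar : C -> nat) : Type :=
| Var (x : nat)
| Cst (c : C) of {ffun 'I_(ar c) -> term ar}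
| TYPE
| KIND
| App of term ar & term ar
| Lam of term ar & term ar
| Pi of term ar & term ar.

Arguments Var {C ar}.
Arguments Cst {C ar}.
Arguments TYPE {C ar}.
Arguments KIND {C ar}.

Section Substitution.
Variables (C : Type) (ar : C -> nat).
Implicit Types (M N A B : term ar) (c : C).

Definition upren (r : nat -> nat) (x : nat) : nat :=
  if x is y.+1 then (r y).+1 else 0.

Fixpoint rename (r : nat -> nat) M : term ar :=
  match M with
  | Var x => Var (r x)
  | Cst c Ms => Cst c [ffun i => rename r (Ms i)]
  | TYPE => TYPE
  | KIND => KIND
  | App M N => App (rename r M) (rename r N)
  | Lam A M => Lam (rename r A) (rename (upren r) M)
  | Pi A B => Pi (rename r A) (rename (upren r) B)
  end.

Definition up (s : nat -> term ar) (x : nat) : term ar :=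
  if x is y.+1 then rename succn (s y) else Var 0.

Fixpoint subst (s : nat -> term ar) M : term ar :=
  match M with
  | Var x => s x
  | Cst c Ms => Cst c [ffun i => subst s (Ms i)]
  | TYPE => TYPE
  | KIND => KIND
  | App M N => App (subst s M) (subst s N)
  | Lam A M => Lam (subst s A) (subst (up s) M)
  | Pi A B => Pi (subst s A) (subst (up s) B)
  end.

(* M{N/x}, for a free variable x; the other free variables are left alone. *)
Definition subst1 (x : nat) N M : term ar :=
  subst (fun y => if y == x then N else Var y) M.

(* Contractum of (Lam A M) N: index 0 of M becomes N and, the binder being
   erased, the remaining free indices of M go down by one. *)
Definition subst_bound N M : term ar :=
  subst (fun y => if y is z.+1 then Var z else N) M.

End Substitution.

(** * Signatures, rules and reduction *)

(* c[Delta] : A.  [dctx i] is the type of the i-th variable of Delta, in scope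
   of the i preceding ones; [dtype] is A, in scope of Delta. *)
Record decl (C : Type) (ar : C -> nat) (c : C) := Decl {
  dctx : {ffun 'I_(ar c) -> term ar};
  dtype : term ar
}.

(* A rule c[l_1, ..., l_n] --> r. *)
Record rule (C : Type) (ar : C -> nat) := Rule {
  rhead : C;
  rargs : {ffun 'I_(ar rhead) -> term ar};
  rrhs : term ar
}.

Record theory (C : Type) (ar : C -> nat) := Theory {
  sig : forall c : C, decl ar c;
  rules : rule ar -> Prop
}.

Section Reduction.
Variables (C : Type) (ar : C -> nat).
Implicit Types (M N A B : term ar) (c : C) (T : theory ar).

Inductive ctx_closure (R : term ar -> term ar -> Prop) :
    term ar -> term ar -> Prop :=
| cc_root M N : R M N -> ctx_closure R M N
| cc_cst c (Ms Ns : {ffun 'I_(ar c) -> term ar}) (i : 'I_(ar c)) :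
    ctx_closure R (Ms i) (Ns i) -> (forall j, j != i -> Ms j = Ns j) ->
    ctx_closure R (Cst c Ms) (Cst c Ns)
| cc_appl M M' N : ctx_closure R M M' -> ctx_closure R (App M N) (App M' N)
| cc_appr M N N' : ctx_closure R N N' -> ctx_closure R (App M N) (App M N')
| cc_laml A A' M : ctx_closure R A A' -> ctx_closure R (Lam A M) (Lam A' M)
| cc_lamr A M M' : ctx_closure R M M' -> ctx_closure R (Lam A M) (Lam A M')
| cc_pil A A' B : ctx_closure R A A' -> ctx_closure R (Pi A B) (Pi A' B)
| cc_pir A B B' : ctx_closure R B B' -> ctx_closure R (Pi A B) (Pi A B').

Inductive beta_root : term ar -> term ar -> Prop :=
| BetaRoot A M N : beta_root (App (Lam A M) N) (subst_bound N M).

Inductive rule_root T : term ar -> term ar -> Prop :=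
| RuleRoot (r : rule ar) (s : nat -> term ar) :
    rules T r -> rule_root T (subst s (Cst (rhead r) (rargs r)))
                             (subst s (rrhs r)).

Definition step_beta := ctx_closure beta_root.

Definition step_rule T := ctx_closure (rule_root T).

Definition step_beta_rule T M N := step_beta M N \/ step_rule T M N.

Definition confluent (R : term ar -> term ar -> Prop) :=
  forall M N P, clos_refl_trans _ R M N -> clos_refl_trans _ R M P ->
  exists Q, clos_refl_trans _ R N Q /\ clos_refl_trans _ R P Q.

(* A is of the form Pi x1 : B1. ... Pi xn : Bn. TYPE, n >= 0. *)
Fixpoint ends_in_TYPE A : bool :=
  match A with
  | TYPE => true
  | Pi _ B => ends_in_TYPE B
  | _ => false
  end.

Definition type_level T c : bool := ends_in_TYPE (dtype (sig T c)).

Definition type_level_rule T (r : rule ar) : bool := type_level T (rhead r).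

(* R ::= alpha[Ms] | R N | \x : A. R *)
Inductive arity_preserving_rhs T : term ar -> Prop :=
| ApCst c Ms : type_level T c -> arity_preserving_rhs T (Cst c Ms)
| ApApp R N : arity_preserving_rhs T R -> arity_preserving_rhs T (App R N)
| ApLam A R : arity_preserving_rhs T R -> arity_preserving_rhs T (Lam A R).

Definition arity_preserving T :=
  forall r, rules T r -> type_level_rule T r -> arity_preserving_rhs T (rrhs r).

Inductive type_family T : term ar -> Prop :=
| TfCst c (Ms : {ffun 'I_(ar c) -> term ar}) :
    type_level T c -> (forall i, object T (Ms i)) -> type_family T (Cst c Ms)
| TfApp A N : type_family T A -> object T N -> type_family T (App A N)
| TfLam A B : type_family T A -> type_family T B -> type_family T (Lam A B)
| TfPi A B : type_family T A -> type_family T B -> type_family T (Pi A B)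
with object T : term ar -> Prop :=
| ObVar x : object T (Var x)
| ObCst c (Ms : {ffun 'I_(ar c) -> term ar}) :
    ~~ type_level T c -> (forall i, object T (Ms i)) -> object T (Cst c Ms)
| ObApp M N : object T M -> object T N -> object T (App M N)
| ObLam A M : type_family T A -> object T M -> object T (Lam A M).

End Reduction.

(** * Untyped lambda-calculus with constants *)

Inductive stype : Type := Star | Arrow of stype & stype.

(* The constants are those of the signature and one pi_sigma for each simple
   type sigma. *)
Inductive lterm (C : Type) : Type :=
| LVar (x : nat)
| LCst (c : C)
| LPi (sigma : stype)
| LApp of lterm C & lterm C
| LLam of lterm C.

Arguments LVar {C}.
Arguments LPi {C}.

Section Untyped.
Variable C : Type.
Implicit Types t u : lterm C.

Fixpoint lrename (r : nat -> nat) t : lterm C :=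
  match t with
  | LVar x => LVar (r x)
  | LCst c => LCst c
  | LPi sigma => LPi sigma
  | LApp t u => LApp (lrename r t) (lrename r u)
  | LLam t => LLam (lrename (upren r) t)
  end.

Definition lup (s : nat -> lterm C) (x : nat) : lterm C :=
  if x is y.+1 then lrename succn (s y) else LVar 0.

Fixpoint lsubst (s : nat -> lterm C) t : lterm C :=
  match t with
  | LVar x => s x
  | LCst c => LCst c
  | LPi sigma => LPi sigma
  | LApp t u => LApp (lsubst s t) (lsubst s u)
  | LLam t => LLam (lsubst (lup s) t)
  end.

Definition lsubst1 (x : nat) u t : lterm C :=
  lsubst (fun y => if y == x then u else LVar y) t.

Definition lsubst_bound u t : lterm C :=
  lsubst (fun y => if y is z.+1 then LVar z else u) t.

Inductive lstep_beta : lterm C -> lterm C -> Prop :=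
| lb_root t u : lstep_beta (LApp (LLam t) u) (lsubst_bound u t)
| lb_appl t t' u : lstep_beta t t' -> lstep_beta (LApp t u) (LApp t' u)
| lb_appr t u u' : lstep_beta u u' -> lstep_beta (LApp t u) (LApp t u')
| lb_lam t t' : lstep_beta t t' -> lstep_beta (LLam t) (LLam t').

Definition lsteps_beta := clos_trans _ lstep_beta.

End Untyped.

(** * The translations

    Both are partial: [None] means undefined. *)

Section Translation.
Variables (C : Type) (ar : C -> nat) (T : theory ar).

(* ||A|| *)
Fixpoint erase_type (A : term ar) : option stype :=
  match A with
  | TYPE => Some Star
  | Cst c _ => if type_level T c then Some Star else None
  | Pi A B =>
      if erase_type A is Some a then
        if erase_type B is Some b then Some (Arrow a b) else None
      else None
  | App A _ => erase_type A
  | Lam _ B => erase_type B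
  | Var _ | KIND => None
  end.

Definition olapp (t u : option (lterm C)) : option (lterm C) :=
  if t is Some t' then if u is Some u' then Some (LApp t' u') else None
  else None.

(* |M| *)
Fixpoint trans (M : term ar) : option (lterm C) :=
  match M with
  | Var x => Some (LVar x)
  | Cst c Ms =>
      foldl (fun t i => olapp t (trans (Ms i))) (Some (LCst c))
            (enum 'I_(ar c))
  | App M N => olapp (trans M) (trans N)
  | Lam A M =>
      (* (\z. \x. |M|) |A|: index 0 of |M| is x, and all other indices skip
         the fresh z. *)
      olapp (omap (fun m => LLam (LLam (lrename (upren succn) m))) (trans M))
            (trans A)
  | Pi A B =>
      olapp (olapp (omap LPi (erase_type A)) (trans A))
            (omap (@LLam C) (trans B))
  | TYPE | KIND => None
  end.

End Translation.

(* Main.v *)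
(** The translation is total on objects and type families and commutes with
    substitution by objects, because such a substitution changes neither the
    syntactic class of a term nor the simple type of a type family.  A redex
    [(\x : A. M) N] becomes [(\z. \x. |M|) |A| |N|], which reaches
    [|M|{|N|/x}] in two steps; a step inside a term is simulated at the
    corresponding place, since the annotation [A] is kept as an argument and
    the simple type indexing [pi] is invariant under beta. *)

Require Import Defs.
From mathcomp Require Import all_boot.
From Stdlib Require Import Relation_Operators.

Set Implicit Arguments.
Unset Strict Implicit.
Unset Printing Implicit Defensive.

(** * Untyped terms *)

Section UntypedTerms.
Variable C : Type.
Implicit Types (t u : lterm C) (r : nat -> nat) (s : nat -> lterm C).

Lemma eq_lrename r1 r2 t : r1 =1 r2 -> lrename r1 t = lrename r2 t.
Proof.
elim: t r1 r2 => //= [x|t IHt u IHu|t IHt] r1 r2 E.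
- by rewrite E.
- by rewrite (IHt _ _ E) (IHu _ _ E).
- by congr LLam; apply: IHt => -[|x] //=; rewrite E.
Qed.

Lemma eq_lsubst s1 s2 t : s1 =1 s2 -> lsubst s1 t = lsubst s2 t.
Proof.
elim: t s1 s2 => //= [t IHt u IHu|t IHt] s1 s2 E.
- by rewrite (IHt _ _ E) (IHu _ _ E).
- by congr LLam; apply: IHt => -[|x] //=; rewrite E.
Qed.

Lemma lsubst_id s t : s =1 LVar -> lsubst s t = t.
Proof.
elim: t s => //= [t IHt u IHu|t IHt] s E.
- by rewrite IHt // IHu.
- by congr LLam; apply: IHt => -[|x] //=; rewrite E.
Qed.

Lemma lrename_comp r1 r2 t : lrename r1 (lrename r2 t) = lrename (r1 \o r2) t.
Proof.
elim: t r1 r2 => //= [t IHt u IHu|t IHt] r1 r2; first by rewrite IHt IHu.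
by rewrite IHt; congr LLam; apply: eq_lrename => -[].
Qed.

Lemma lsubst_lrename s r t : lsubst s (lrename r t) = lsubst (s \o r) t.
Proof.
elim: t s r => //= [t IHt u IHu|t IHt] s r; first by rewrite IHt IHu.
by rewrite IHt; congr LLam; apply: eq_lsubst => -[].
Qed.

Lemma lrename_lsubst r s t :
  lrename r (lsubst s t) = lsubst (lrename r \o s) t.
Proof.
elim: t r s => //= [t IHt u IHu|t IHt] r s; first by rewrite IHt IHu.
rewrite IHt; congr LLam; apply: eq_lsubst => -[|x] //=.
by rewrite !lrename_comp; apply: eq_lrename.
Qed.

(** The spine of a translated constant, built by the same left fold as in [trans] but with arguments
    that are always defined. *)
Definition lapps (I : Type) (h : lterm C) (g : I -> lterm C) (l : seq I) :=
  foldl (fun t i => LApp t (g i)) h l.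

Lemma lapps_rcons I h (g : I -> lterm C) l i :
  lapps h g (rcons l i) = LApp (lapps h g l) (g i).
Proof. by rewrite /lapps -cats1 foldl_cat. Qed.

Lemma lrename_lapps I h (g : I -> lterm C) l r :
  lrename r (lapps h g l) = lapps (lrename r h) (lrename r \o g) l.
Proof. by elim: l h => //= i l IH h; rewrite IH. Qed.

Lemma lsubst_lapps I h (g : I -> lterm C) l s :
  lsubst s (lapps h g l) = lapps (lsubst s h) (lsubst s \o g) l.
Proof. by elim: l h => //= i l IH h; rewrite IH. Qed.

Lemma eq_in_lapps (I : eqType) h (g g' : I -> lterm C) l :
  {in l, g =1 g'} -> lapps h g l = lapps h g' l.
Proof.
elim: l h => //= i l IH h E; rewrite E ?mem_head // IH // => j jl.
by apply: E; rewrite in_cons jl orbT.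
Qed.

(** * Compatibility of multi-step beta with contexts and renaming *)

Lemma clos_trans_homo (A B : Type) (R : A -> A -> Prop) (R' : B -> B -> Prop)
    (f : A -> B) x y :
  (forall x y, R x y -> R' (f x) (f y)) ->
  clos_trans _ R x y -> clos_trans _ R' (f x) (f y).
Proof.
move=> fR; elim=> [x1 y1 /fR|x1 y1 z1 _ IH1 _ IH2]; first exact: t_step.
exact: t_trans IH1 IH2.
Qed.

Lemma lsteps_appl t t' u :
  lsteps_beta t t' -> lsteps_beta (LApp t u) (LApp t' u).
Proof.
by apply: (clos_trans_homo (f := fun t => LApp t u)) => ? ?; apply: lb_appl.
Qed.

Lemma lsteps_appr t u u' :
  lsteps_beta u u' -> lsteps_beta (LApp t u) (LApp t u').
Proof. by apply: (clos_trans_homo (f := LApp t)) => ? ?; apply: lb_appr. Qed.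

Lemma lsteps_lam t t' : lsteps_beta t t' -> lsteps_beta (LLam t) (LLam t').
Proof. by apply: (clos_trans_homo (f := @LLam C)) => ? ?; apply: lb_lam. Qed.

(** The body of a translated abstraction sits under a renaming that skips [z], so steps in the body
    must survive it. *)
Lemma lstep_rename r t t' :
  lstep_beta t t' -> lstep_beta (lrename r t) (lrename r t').
Proof.
move=> S; elim: S r => /= [{}t u|{}t {}t' u _ IH|{}t u u' _ IH|{}t {}t' _ IH] r.
- suff ->: lrename r (lsubst_bound u t) =
           lsubst_bound (lrename r u) (lrename (upren r) t) by apply: lb_root.
  rewrite /lsubst_bound lrename_lsubst lsubst_lrename.
  by apply: eq_lsubst => -[].
- exact: lb_appl.
- exact: lb_appr.
- exact: lb_lam.
Qed.

Lemma lsteps_rename r t t' :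
  lsteps_beta t t' -> lsteps_beta (lrename r t) (lrename r t').
Proof. by apply: clos_trans_homo => ? ?; apply: lstep_rename. Qed.

(** A spine grows on the right, hence induction from the last element. Since [l] has no repetition,
    [i] is either the last index, and then the prefix is unchanged, or it lies in the prefix, and
    then the last argument is unchanged. *)
Lemma lsteps_lapps (I : eqType) h (g g' : I -> lterm C) l i :
  uniq l -> i \in l -> lsteps_beta (g i) (g' i) ->
  (forall j, j != i -> g j = g' j) ->
  lsteps_beta (lapps h g l) (lapps h g' l).
Proof.
move=> + + Si E; elim/last_ind: l => // l j IH.
rewrite rcons_uniq mem_rcons in_cons !lapps_rcons => /andP[jl ul].
case: (eqVneq i j) => [eij _|neq il]; last first.
  by rewrite (E j) 1?eq_sym //; apply/lsteps_appl/IH.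
rewrite (@eq_in_lapps _ h g g' l) -?eij; first exact: lsteps_appr.
by move=> k kl; apply: E; apply: contraNneq jl => eki; rewrite -eij -eki.
Qed.

End UntypedTerms.

(** * Objects and type families *)

(** The arguments of [Cst] are nested in a finite function, so the induction hypothesis for each of
    them is supplied by an explicit fixpoint. *)
Lemma nested_term_ind (C : Type) (ar : C -> nat) (P : term ar -> Prop) :
  (forall x, P (Var x)) ->
  (forall c (Ms : {ffun 'I_(ar c) -> term ar}),
     (forall i, P (Ms i)) -> P (Cst c Ms)) ->
  P TYPE -> P KIND ->
  (forall M N, P M -> P N -> P (App M N)) ->
  (forall A M, P A -> P M -> P (Lam A M)) ->
  (forall A B, P A -> P B -> P (Pi A B)) ->
  forall M, P M.
Proof.
move=> hv hc ht hk ha hl hp; fix IH 1.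
case=> [x|c Ms|||M N|A M|A B].
- exact: hv.
- exact: hc (fun i => IH (Ms i)).
- exact: ht.
- exact: hk.
- exact: ha (IH M) (IH N).
- exact: hl (IH A) (IH M).
- exact: hp (IH A) (IH B).
Qed.

Scheme type_family_mut := Minimality for type_family Sort Prop
with object_mut := Minimality for object Sort Prop.
Combined Scheme type_family_object_ind from type_family_mut, object_mut.

Section Expressions.
Variables (C : Type) (ar : C -> nat) (T : theory ar).
Implicit Types (M N A B : term ar) (r : nat -> nat) (s : nat -> term ar).

Definition expr M := object T M \/ type_family T M.

(** Phrasing the inversion as a [match] yields the dependent family [Ms] itself, with no equality
    between dependent pairs to eliminate. *)
Lemma object_inv M : object T M ->
  match M with
  | Var _ => True
  | Cst c Ms => ~~ type_level T c /\ forall i, object T (Ms i)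
  | App M N => object T M /\ object T N
  | Lam A M => type_family T A /\ object T M
  | _ => False
  end.
Proof. by case. Qed.

Lemma type_family_inv M : type_family T M ->
  match M with
  | Cst c Ms => type_level T c /\ forall i, object T (Ms i)
  | App M N => type_family T M /\ object T N
  | Lam A M | Pi A M => type_family T A /\ type_family T M
  | _ => False
  end.
Proof. by case. Qed.

(** The products keep the extra information that the domain is a type family: this is what makes the
    index of [LPi] defined. *)
Lemma expr_inv M : expr M ->
  match M with
  | Var _ => True
  | Cst c Ms => forall i, expr (Ms i)
  | App M N => expr M /\ expr N
  | Lam A M => expr A /\ expr M
  | Pi A B => [/\ expr A, expr B & type_family T A]
  | _ => False
  end.
Proof.
rewrite /expr; case: M => [x|c Ms|||M N|A M|A B] //.
- by case=> [/object_inv|/type_family_inv] [_ oMs] i; left.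
- by case=> // [/object_inv|/type_family_inv].
- by case=> // [/object_inv|/type_family_inv].
- by case=> [/object_inv|/type_family_inv] []; tauto.
- by case=> [/object_inv|/type_family_inv] []; tauto.
- by case=> [/object_inv|/type_family_inv] [] //; split; tauto.
Qed.

(** * Stability of the two classes under renaming, substitution and beta *)

Lemma type_family_object_rename :
  (forall A, type_family T A -> forall r, type_family T (rename r A)) /\
  (forall M, object T M -> forall r, object T (rename r M)).
Proof.
apply: type_family_object_ind => /= *; constructor=> // *;
  by rewrite ?ffunE; auto.
Qed.

Lemma expr_rename r M : expr M -> expr (rename r M).
Proof.
by case=> [oM|tM]; [left|right]; apply type_family_object_rename.
Qed.

Lemma object_up s : (forall x, object T (s x)) -> forall x, object T (up s x).
Proof.
move=> os [|x] /=; first exact: ObVar.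
exact: type_family_object_rename.2.
Qed.

(** Variables are generated by the grammar of objects only, so putting objects in their place
    respects both grammars. *)
Lemma type_family_object_subst :
  (forall A, type_family T A ->
     forall s, (forall x, object T (s x)) -> type_family T (subst s A)) /\
  (forall M, object T M ->
     forall s, (forall x, object T (s x)) -> object T (subst s M)).
Proof.
(* Placed in the context so that [auto] can go under binders. *)
have upP := object_up.
apply: type_family_object_ind => /=;
  try by constructor=> // *; rewrite ?ffunE; auto.
by move=> x s; apply.
Qed.

Lemma object_subst s M :
  (forall x, object T (s x)) -> object T M -> object T (subst s M).
Proof. by move=> os oM; apply: type_family_object_subst.2. Qed.

Lemma type_family_subst s A :
  (forall x, object T (s x)) -> type_family T A -> type_family T (subst s A).
Proof. by move=> os tA; apply: type_family_object_subst.1. Qed.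

Lemma expr_subst s M :
  (forall x, object T (s x)) -> expr M -> expr (subst s M).
Proof.
move=> os [oM|tM]; first by left; apply: object_subst.
by right; apply: type_family_subst.
Qed.

Lemma object_bound N :
  object T N -> forall x, object T (if x is y.+1 then Var y else N).
Proof. by move=> oN [|x] //; apply: ObVar. Qed.

(** At the root, the class of a redex is the class of the body of its abstraction, and the argument
    is an object in both cases. The two implications are proved together because annotations of
    objects are type families whose arguments are again objects. *)
Lemma step_beta_class M N : step_beta M N ->
  (object T M -> object T N) /\ (type_family T M -> type_family T N).
Proof.
elim=> {M N} [_ _ [A M N]|c Ms Ns i _ [IH _] E|M M' N _ [IHo IHt]
  |M N N' _ [IHo _]|A A' M _ [_ IHt]|A M M' _ [IHo IHt]|A A' B _ [_ IHt]
  |A B B' _ [_ IHt]].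
- split=> [/object_inv[/object_inv[_ oM] oN]
          |/type_family_inv[/type_family_inv[_ tM] oN]].
  + exact: (object_subst (object_bound oN)).
  + exact: (type_family_subst (object_bound oN)).
- have oNs : (forall j, object T (Ms j)) -> forall j, object T (Ns j).
    by move=> oMs j; have [->|/E<-] := eqVneq j i; [apply: IH|].
  by split=> [/object_inv|/type_family_inv] [? ?]; constructor=> //; apply: oNs.
all: by split=> [/object_inv|/type_family_inv] // [? ?]; constructor; auto.
Qed.

Lemma step_beta_expr M N : step_beta M N -> expr M -> expr N.
Proof. by move/step_beta_class=> [ho ht] [/ho|/ht]; [left|right]. Qed.

(** * Invariance of the simple type of a type family *)

Lemma erase_type_rename r A : erase_type T (rename r A) = erase_type T A.
Proof.
by elim: A r => //= A IHA B IHB r; rewrite IHA IHB.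
Qed.

(** [erase_type] inspects only heads, bodies and products, and in a type family none of these
    positions holds a variable. For an arbitrary term, substitution could make an undefined value
    defined. *)
Lemma erase_type_subst s A :
  type_family T A -> erase_type T (subst s A) = erase_type T A.
Proof.
elim: A s => [x|c Ms|||A IHA N _|A _ B IHB|A IHA B IHB] s /type_family_inv //=.
- by case=> /IHA->.
- by case=> _ /IHB->.
- by case=> /IHA-> /IHB->.
Qed.

Lemma erase_type_some A : type_family T A -> exists a, erase_type T A = Some a.
Proof.
elim: A => [x|c Ms|||A IHA N _|A _ B IHB|A IHA B IHB] /type_family_inv //=.
- by case=> -> _; exists Star.
- by case=> /IHA.
- by case=> _ /IHB.
- by case=> /IHA[a ->] /IHB[b ->]; exists (Arrow a b).
Qed.

(** A redex has the simple type of the body of its abstraction, which the contraction merely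
    substitutes into; steps in arguments or annotations are invisible. *)
Lemma erase_type_step A B :
  step_beta A B -> type_family T A -> erase_type T B = erase_type T A.
Proof.
elim=> {A B} [_ _ [A M N]|c Ms Ns i _ _ _|M M' N _ IH|M N N' _ _
  |A A' M _ _|A M M' _ IH|A A' B _ IH|A B B' _ IH] /type_family_inv //=.
- by case=> /type_family_inv[_ tM] _; apply: erase_type_subst.
- by case=> /IH.
- by case=> _ /IH.
- by case=> /IH-> _.
- by case=> _ /IH->.
Qed.

(** * The translation as a total function *)

(* The values [LVar 0] and [Star] taken where [trans] and [erase_type] are
   undefined are junk. *)
Definition tr M : lterm C := odflt (LVar 0) (trans T M).
Definition er A : stype := odflt Star (erase_type T A).

Lemma trans_cst c (Ms : {ffun 'I_(ar c) -> term ar}) :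
  (forall i, trans T (Ms i) = Some (tr (Ms i))) ->
  trans T (Cst c Ms) =
    Some (lapps (LCst c) (fun i => tr (Ms i)) (enum 'I_(ar c))).
Proof.
(* The head is the accumulator of the fold, so it is generalized before the induction. *)
move=> E /=; move: (LCst c); elim: (enum _) => //= i l IH h.
by rewrite E /= IH.
Qed.

Lemma trans_tr M : expr M -> trans T M = Some (tr M).
Proof.
elim/nested_term_ind: M
  => [x|c Ms IH|||M N IHM IHN|A M IHA IHM|A B IHA IHB] /expr_inv //.
- by move=> eMs; rewrite /tr trans_cst // => i; apply: IH.
- by case=> /IHM EM /IHN EN; rewrite /tr /= EM EN.
- by case=> /IHA EA /IHM EM; rewrite /tr /= EA EM.
- case=> /IHA EA /IHB EB /erase_type_some[a Ea].
  by rewrite /tr /= EA EB Ea.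
Qed.

Lemma tr_cst c (Ms : {ffun 'I_(ar c) -> term ar}) :
  (forall i, expr (Ms i)) ->
  tr (Cst c Ms) = lapps (LCst c) (fun i => tr (Ms i)) (enum 'I_(ar c)).
Proof. by move=> eMs; rewrite {1}/tr trans_cst // => i; apply: trans_tr. Qed.

Lemma tr_app M N : expr M -> expr N -> tr (App M N) = LApp (tr M) (tr N).
Proof. by move=> eM eN; rewrite {1}/tr /= !trans_tr. Qed.

Lemma tr_lam A M : expr A -> expr M ->
  tr (Lam A M) = LApp (LLam (LLam (lrename (upren succn) (tr M)))) (tr A).
Proof. by move=> eA eM; rewrite {1}/tr /= !trans_tr. Qed.

Lemma tr_pi A B : type_family T A -> expr B ->
  tr (Pi A B) = LApp (LApp (LPi (er A)) (tr A)) (LLam (tr B)).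
Proof.
move=> tA eB; rewrite {1}/tr /er /=; have [a ->] := erase_type_some tA.
by rewrite !trans_tr //; right.
Qed.

(** * Commutation of the translation with renaming and substitution *)

Lemma tr_rename r M : expr M -> tr (rename r M) = lrename r (tr M).
Proof.
elim/nested_term_ind: M r
  => [x|c Ms IH|||M N IHM IHN|A M IHA IHM|A B IHA IHB] r /expr_inv //=.
- move=> eMs; rewrite !tr_cst // => [|i]; last first.
    by rewrite ffunE; apply: expr_rename.
  rewrite lrename_lapps; apply: eq_in_lapps => i _ /=.
  by rewrite ffunE IH.
- case=> eM eN; rewrite !tr_app ?IHM ?IHN //; exact: expr_rename.
- case=> eA eM; rewrite !tr_lam ?IHA ?IHM //=; try exact: expr_rename.
  congr (LApp (LLam (LLam _)) _); rewrite !lrename_comp.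
  by apply: eq_lrename => -[].
- case=> eA eB tA; rewrite !tr_pi ?IHA ?IHB //=; last exact: expr_rename.
    by rewrite /er erase_type_rename.
  exact: type_family_object_rename.1.
Qed.

Lemma tr_up s :
  (forall x, object T (s x)) ->
  (fun x => tr (up s x)) =1 lup (fun x => tr (s x)).
Proof. by move=> os [|x] //=; apply: tr_rename; left. Qed.

Lemma tr_subst s M : (forall x, object T (s x)) -> expr M ->
  tr (subst s M) = lsubst (fun x => tr (s x)) (tr M).
Proof.
elim/nested_term_ind: M s
  => [x|c Ms IH|||M N IHM IHN|A M IHA IHM|A B IHA IHB] s os /expr_inv //=.
- move=> eMs; rewrite !tr_cst // => [|i]; last first.
    by rewrite ffunE; apply: expr_subst.
  rewrite lsubst_lapps; apply: eq_in_lapps => i _ /=.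
  by rewrite ffunE IH.
- case=> eM eN; rewrite !tr_app ?IHM ?IHN //; exact: expr_subst.
- have ous := object_up os.
  case=> eA eM; rewrite !tr_lam ?IHA ?IHM //=; try exact: expr_subst.
  congr (LApp (LLam (LLam _)) _).
  (* Both sides are now substitutions into [tr M]. Index 0 is fixed, and index [x.+1] goes to
     [tr (s x)] shifted by two, once for [x] and once for [z]. *)
  rewrite lrename_lsubst lsubst_lrename; apply: eq_lsubst => x /=.
  rewrite tr_up //; case: x => //= x.
  by rewrite !lrename_comp; apply: eq_lrename.
- have ous := object_up os.
  case=> eA eB tA; rewrite !tr_pi ?IHA ?IHB //=; last exact: expr_subst.
    rewrite /er erase_type_subst //; congr (LApp _ (LLam _)).
    exact/eq_lsubst/tr_up.
  exact: type_family_subst.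
Qed.

(** * Simulation of a beta step *)

Lemma tr_step M N : expr M -> step_beta M N -> lsteps_beta (tr M) (tr N).
Proof.
move=> + S; elim: S => {M N} [_ _ [A M N]|c Ms Ns i S IH E|M M' N S IH
  |M N N' S IH|A A' M S IH|A M M' S IH|A A' B S IH|A B B' S IH] eMN.
- have oN : object T N by case: eMN => [/object_inv|/type_family_inv] [].
  have [/[dup] eL /expr_inv[eA eM] eN] := expr_inv eMN.
  rewrite tr_app // tr_lam // /subst_bound.
  rewrite tr_subst //; last exact: object_bound.
  (* The intermediate term is what remains once the outer redex, binding [z], has consumed the
     annotation. *)
  apply: (t_trans _ _ _ (LApp (LLam (tr M)) (tr N))); apply: t_step.
    apply: lb_appl; set u := LLam (lrename _ _).
    (* After the renaming by [upren succn], [z] does not occur, so [tr A] is discarded and lowering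
       the indices undoes the shift. *)
    suff E : lsubst_bound (tr A) u = LLam (tr M) by rewrite -E; apply: lb_root.
    by rewrite /lsubst_bound /= lsubst_lrename lsubst_id // => -[].
  suff -> : lsubst (fun x => tr (if x is y.+1 then Var y else N)) (tr M)
            = lsubst_bound (tr N) (tr M) by apply: lb_root.
  by apply: eq_lsubst => -[].
- have eMs := expr_inv eMN.
  have eNs := expr_inv (step_beta_expr (cc_cst S E) eMN).
  rewrite !tr_cst //; apply: (@lsteps_lapps _ _ _ _ _ _ i);
    rewrite ?enum_uniq ?mem_enum //.
    exact: IH.
  by move=> j /E ->.
- have [eM eN] := expr_inv eMN; have eM' := step_beta_expr S eM.
  by rewrite !tr_app //; apply/lsteps_appl/IH.
- have [eM eN] := expr_inv eMN; have eN' := step_beta_expr S eN.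
  by rewrite !tr_app //; apply/lsteps_appr/IH.
- have [eA eM] := expr_inv eMN; have eA' := step_beta_expr S eA.
  by rewrite !tr_lam //; apply/lsteps_appr/IH.
- have [eA eM] := expr_inv eMN; have eM' := step_beta_expr S eM.
  rewrite !tr_lam //.
  exact/lsteps_appl/lsteps_lam/lsteps_lam/lsteps_rename/IH.
- have [eA eB tA] := expr_inv eMN; have tA' := (step_beta_class S).2 tA.
  (* The index of [LPi] is the same before and after the step, so only the first argument moves. *)
  rewrite !tr_pi // /er (erase_type_step S) //.
  exact/lsteps_appl/lsteps_appr/IH.
- have [eA eB tA] := expr_inv eMN; have eB' := step_beta_expr S eB.
  by rewrite !tr_pi //; apply/lsteps_appr/lsteps_lam/IH.
Qed.

End Expressions.

Theorem mainTheorem7 (C : Type) (ar : C -> nat) (T : theory ar)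
    (hconf : confluent (step_beta_rule T)) (harity : arity_preserving T)
    (M : term ar) (hM : object T M \/ type_family T M) :
  (forall (N : term ar) (x : nat), object T N ->
     (object T (subst1 x N M) \/ type_family T (subst1 x N M)) /\
     exists m n : lterm C,
       [/\ trans T M = Some m, trans T N = Some n
         & trans T (subst1 x N M) = Some (lsubst1 x n m)]) /\
  (forall N : term ar, step_beta M N ->
     (object T N \/ type_family T N) /\
     exists m n : lterm C,
       [/\ trans T M = Some m, trans T N = Some n & lsteps_beta m n]).
Proof.
split=> [N x oN|N S].
  (* The substitution of one variable is treated as a parallel substitution all of whose values are
     objects. *)
  have os y : object T (if y == x then N else Var y).
    by case: ifP => // _; apply: ObVar.
  have eS : expr T (subst1 x N M) := expr_subst os hM.
  split=> //; exists (tr T M), (tr T N).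
  split; [exact: trans_tr|by apply: trans_tr; left|].
  rewrite trans_tr // /subst1 tr_subst //; congr Some.
  by apply: eq_lsubst => y; case: ifP.
have eN : expr T N := step_beta_expr S hM.
split=> //; exists (tr T M), (tr T N).
by split; [exact: trans_tr|exact: trans_tr|exact: tr_step].
Qed.
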